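(* Let $\Gamma\in\{G,W,O\}$, let $[\Gamma,\mathbb{B}]$ be the corresponding invariant line, and assume $\nu_\Gamma<1$. Let $M$ be a state on this line with $s_M\in[s_{\mathcal{U}},s_{\mathbb{B}_0}]$, and let $U$ be a state on this line with $s_U\in[0,s_{\mathcal{U}}]$. Then there is a transitional rarefaction wave between $U$ (left) and $M$ (right), with the transition between the fast and the slow rarefaction at the umbilic point $\mathcal{U}$. There are two cases: (a) If $s_M\in(s_{\mathcal{U}},s_{\mathbb{I}}]$, the transitional rarefaction consists of the sequence of waves $$U\xrightarrow{R_f}\mathcal{U}\xrightarrow{R_s}M.$$ (b) If $s_M\in(s_{\mathbb{I}},s_{\mathbb{B}_0}]$, then there is a state $M_3$ on the line with $s_{M_3}\in[s_{\mathcal{U}},s_{\mathbb{I}})$ and $\sigma(M_3;M)=\lambda_s(M_3)$ such that the transitional rarefaction consists of the sequence of waves $$U\xrightarrow{R_f}\mathcal{U}\xrightarrow{R_s}M_3\xrightarrow{'S_s}M.$$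
   Context: Model. Let $\mu_w,\mu_o,\mu_g>0$ be the viscosities of water, oil, gas. Saturations are $s_w,s_o,s_g\ge 0$ with $s_w+s_o+s_g=1$; the saturation triangle is $\Omega=\{(s_w,s_o): s_w,s_o\ge0,\ s_w+s_o\le1\}$, with vertices $W,O,G$ where $s_w=1$, $s_o=1$, $s_g=1$ respectively. The flux is $F=(f_w,f_o)$ with $f_i=(s_i^2/\mu_i)/(\sum_{j\in\{w,o,g\}}s_j^2/\mu_j)$, and the system is $U_t+F(U)_x=0$, $U=(s_w,s_o)^T$. Denote by $\lambda_s(U)\le\lambda_f(U)$ the (slow and fast) eigenvalues of $DF(U)$. The umbilic point, where $\lambda_s=\lambda_f$, is $\mathcal{U}$ with $(s_w,s_o,s_g)=(\mu_w,\mu_o,\mu_g)/(\mu_w+\mu_o+\mu_g)$. Invariant lines. For $\Gamma\in\{G,W,O\}$ let $\gamma$ be the corresponding phase ($g,w,o$) and $\alpha,\beta$ the other two phases. Put $\nu_\Gamma=(\mu_\alpha+\mu_\beta)/\mu_\gamma$. The invariant line $[\Gamma,\mathbb{B}]$ is the set of states with $s_\alpha/\mu_\alpha=s_\beta/\mu_\beta$; it is parametrized by the effective saturation $s=s_\alpha+s_\beta\in[0,1]$, with $s=0$ at the vertex $\Gamma$ and $s=1$ at the point $\mathbb{B}$ on the opposite edge ($\mathbb{B}$ is named $D,E,B$ for $\Gamma=G,W,O$). For a state $M$ on this line, $s_M$ denotes its effective saturation; $s_{\mathcal{U}}=\nu_\Gamma/(1+\nu_\Gamma)$. With $E(s)=s^2+\nu_\Gamma(1-s)^2$,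 the eigenvalues of $DF$ along the line are $\lambda_a(s)=2s/E(s)$ and $\lambda_b(s)=2\nu_\Gamma s(1-s)/E(s)^2$, and $\lambda_s=\min\{\lambda_a,\lambda_b\}$, $\lambda_f=\max\{\lambda_a,\lambda_b\}$; $\lambda_b=f'$ where $f(s)=s^2/E(s)$ is the reduced flux along the line (its eigenvector is tangent to the line). The Rankine-Hugoniot speed $\sigma(M;N)$ between two states of the line (i.e. $F(N)-F(M)=\sigma(N-M)$) is $\sigma(M;N)=\nu_\Gamma(s_M+s_N-2s_Ms_N)/(E(s_M)E(s_N))$. Special states. $\mathbb{B}_0$ is the state of the line with $\sigma(\mathbb{B}_0;\mathcal{U})=\lambda_s(\mathcal{U})=\lambda_f(\mathcal{U})=2$ given by $s_{\mathbb{B}_0}=1/2$. $s_{\mathbb{I}}$ is the inflection point of $f$, i.e. the unique solution in $[0,1]$ of $2s^3-3s^2+s_{\mathcal{U}}=0$; for $\nu_\Gamma<1$ one has $s_{\mathcal{U}}<s_{\mathbb{I}}<1/2$. Waves. For $i\in\{s,f\}$, $A\xrightarrow{R_i}B$ denotes an $i$-rarefaction from $A$ (left) to $B$ (right): a continuous self-similar solution $\widehat U(x/t)$ along an integral curve of the eigenvector of $\lambda_i$ joining $A$ to $B$, with $\xi=x/t=\lambda_i(\widehat U(\xi))$ increasing from $A$ to $B$. $A\xrightarrow{'S_s}B$ denotes a left-characteristic $s$-shock: a discontinuity satisfying the Rankine-Hugoniot condition with speed $\sigma=\lambda_s(A)$, $\lambda_s(B)<\sigma<\lambda_f(B)$,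 with a viscous profile (for the identity viscosity matrix, an orbit of $\dot U=F(U)-F(A)-\sigma(U-A)$ from $A$ to $B$). A wave sequence $A\xrightarrow{a}B\xrightarrow{b}C$ must be compatible: the final speed of wave $a$ is at most the initial speed of wave $b$. Waves whose two end states coincide are trivial. A transitional rarefaction arises when an integral curve of the fast family is followed by an integral curve of the slow family in the direction of increasing characteristic speed, the two characteristic speeds coinciding at the junction point; in case (b) the term also covers the sequence that continues with the left-characteristic $s$-shock. *)

(* Defs.v *)
From HB Require Import structures.
From mathcomp Require Import all_boot all_order all_algebra.
From mathcomp Require Import all_classical all_reals all_analysis.

Set Implicit Arguments.
Unset Strict Implicit.
Unset Printing Implicit Defensive.

Import Order.TTheory GRing.Theory Num.Theory.
Import numFieldNormedType.Exports.

Local Open Scope classical_set_scope.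
Local Open Scope ring_scope.

Inductive phase := Water | Oil | Gas.

(* The two phases other than the given one. The vertex of the saturation
   triangle where a phase has saturation 1 is denoted by that phase. *)
Definition alpha (c : phase) : phase :=
  match c with Water => Oil | Oil => Water | Gas => Water end.
Definition beta (c : phase) : phase :=
  match c with Water => Gas | Oil => Gas | Gas => Oil end.

(* A state is the row vector (s_w, s_o); the gas saturation is 1 - s_w - s_o. *)
Definition sat (R : realType) (p : phase) (U : 'rV[R]_2) : R :=
  match p with
  | Water => U ord0 ord0
  | Oil => U ord0 ord_max
  | Gas => 1 - U ord0 ord0 - U ord0 ord_max
  end.

Definition triangle (R : realType) : set 'rV[R]_2 :=
  [set U | forall p : phase, 0 <= sat p U].

Definition state_of (R : realType) (sw so : R) : 'rV[R]_2 :=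
  \row_(i < 2) (if i == ord0 then sw else so).

Definition frac_flow (R : realType) (mu : phase -> R) (p : phase)
    (U : 'rV[R]_2) : R :=
  (sat p U ^+ 2 / mu p) /
  (sat Water U ^+ 2 / mu Water + sat Oil U ^+ 2 / mu Oil
   + sat Gas U ^+ 2 / mu Gas).

Definition flux (R : realType) (mu : phase -> R) (U : 'rV[R]_2) : 'rV[R]_2 :=
  state_of (frac_flow mu Water U) (frac_flow mu Oil U).

(* [jacobian] acts on row vectors: v *m DF mu U is the differential of the flux
   at U applied to v, so that the row eigenvectors of this matrix are the
   (right) eigenvectors of the Jacobian matrix in the usual column notation. *)
Definition DF (R : realType) (mu : phase -> R) (U : 'rV[R]_2) : 'M[R]_2 :=
  jacobian (flux mu) U.

Inductive wave_family := Slow | Fast.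

(* DF has at most two eigenvalues, so that inf and sup are the smaller and the
   larger one; they coincide at a point with a double eigenvalue. *)
Definition lambda (R : realType) (mu : phase -> R) (i : wave_family)
    (U : 'rV[R]_2) : R :=
  match i with
  | Slow => inf [set l : R | eigenvalue (DF mu U) l]
  | Fast => sup [set l : R | eigenvalue (DF mu U) l]
  end.

Definition is_eigenvector (R : realType) (A : 'M[R]_2) (l : R)
    (v : 'rV[R]_2) : Prop :=
  v != 0 /\ (v <= eigenspace A l)%MS.

Definition umbilic (R : realType) (mu : phase -> R) : 'rV[R]_2 :=
  state_of (mu Water / (mu Water + mu Oil + mu Gas))
           (mu Oil / (mu Water + mu Oil + mu Gas)).

Definition nu (R : realType) (mu : phase -> R) (c : phase) : R :=
  (mu (alpha c) + mu (beta c)) / mu c.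

Definition invariant_line (R : realType) (mu : phase -> R) (c : phase) :
    set 'rV[R]_2 :=
  [set U | triangle U /\
           sat (alpha c) U / mu (alpha c) = sat (beta c) U / mu (beta c)].

Definition eff_sat (R : realType) (c : phase) (U : 'rV[R]_2) : R :=
  sat (alpha c) U + sat (beta c) U.

(* Effective saturation of the state, other than the umbilic point, whose
   Rankine-Hugoniot speed to the umbilic point is 2, the double eigenvalue of DF
   there; it is the same on the three lines and for all viscosities. *)
Definition s_B0 (R : realType) : R := 1 / 2.

(* Effective saturation of the inflection point of the reduced flux
   s^2 / (s^2 + nu (1 - s)^2): the unique root in [0, 1] of the cubic. *)
Definition s_inflection (R : realType) (mu : phase -> R) (c : phase) : R :=
  xget 0 [set s : R | 0 <= s <= 1 /\
    2 * s ^+ 3 - 3 * s ^+ 2 + eff_sat c (umbilic mu) = 0].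

Definition RH_speed (R : realType) (mu : phase -> R) (A B : 'rV[R]_2)
    (sigma : R) : Prop :=
  flux mu B - flux mu A = sigma *: (B - A).

(* Uh is the profile of the wave as a function of xi = x / t. Its derivative is
   only required inside the fan: it blows up at an end state where the
   characteristic speed is stationary along the integral curve (an inflection).
   The trivial wave A = B is included. *)
Definition rarefaction (R : realType) (mu : phase -> R) (i : wave_family)
    (A B : 'rV[R]_2) : Prop :=
  triangle A /\ triangle B /\ lambda mu i A <= lambda mu i B /\
  exists Uh : R -> 'rV[R]_2,
    [/\ Uh (lambda mu i A) = A, Uh (lambda mu i B) = B,
        {within `[lambda mu i A, lambda mu i B], continuous Uh} &
        forall xi : R, lambda mu i A < xi < lambda mu i B ->
          [/\ triangle (Uh xi), lambda mu i (Uh xi) = xi,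
              derivable Uh xi 1 &
              is_eigenvector (DF mu (Uh xi)) (lambda mu i (Uh xi))
                (derive1 Uh xi)]].

Definition viscous_profile (R : realType) (mu : phase -> R)
    (A B : 'rV[R]_2) (sigma : R) : Prop :=
  exists phi : R -> 'rV[R]_2,
    [/\ forall t : R, triangle (phi t),
        forall t : R, is_derive t (1 : R) phi
          (flux mu (phi t) - flux mu A - sigma *: (phi t - A)),
        phi @ -oo --> A &
        phi @ +oo --> B].

Definition left_char_slow_shock (R : realType) (mu : phase -> R)
    (A B : 'rV[R]_2) : Prop :=
  let sigma := lambda mu Slow A in
  [/\ triangle A /\ triangle B, RH_speed mu A B sigma,
      lambda mu Slow B < sigma < lambda mu Fast B &
      viscous_profile mu A B sigma].

Inductive wave := Rarefaction of wave_family | LeftCharSlowShock.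

Definition is_wave (R : realType) (mu : phase -> R) (w : wave)
    (A B : 'rV[R]_2) : Prop :=
  match w with
  | Rarefaction i => rarefaction mu i A B
  | LeftCharSlowShock => left_char_slow_shock mu A B
  end.

Definition initial_speed (R : realType) (mu : phase -> R) (w : wave)
    (A B : 'rV[R]_2) : R :=
  match w with
  | Rarefaction i => lambda mu i A
  | LeftCharSlowShock => lambda mu Slow A
  end.

Definition final_speed (R : realType) (mu : phase -> R) (w : wave)
    (A B : 'rV[R]_2) : R :=
  match w with
  | Rarefaction i => lambda mu i B
  | LeftCharSlowShock => lambda mu Slow A
  end.

(* A -w1-> B1 -w2-> B2 ... is encoded as A and [:: (w1, B1); (w2, B2); ...]. *)
Fixpoint wave_sequence (R : realType) (mu : phase -> R) (A : 'rV[R]_2)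
    (ws : seq (wave * 'rV[R]_2)) : Prop :=
  match ws with
  | [::] => True
  | (w, B) :: ws' =>
      [/\ is_wave mu w A B,
          match ws' with
          | [::] => True
          | (w', C) :: _ => final_speed mu w A B <= initial_speed mu w' B C
          end &
          wave_sequence mu B ws']
  end.

(* [transitional_rarefaction mu U J M ws]: ws is a transitional rarefaction from
   U to M whose fast-to-slow transition takes place at J. *)
Inductive transitional_rarefaction (R : realType) (mu : phase -> R)
    (U J M : 'rV[R]_2) : seq (wave * 'rV[R]_2) -> Prop :=
| TransRarefaction :
    lambda mu Fast J = lambda mu Slow J ->
    wave_sequence mu U [:: (Rarefaction Fast, J); (Rarefaction Slow, M)] ->
    transitional_rarefaction mu U J M
      [:: (Rarefaction Fast, J); (Rarefaction Slow, M)]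
| TransRarefactionShock (M3 : 'rV[R]_2) :
    lambda mu Fast J = lambda mu Slow J ->
    wave_sequence mu U
      [:: (Rarefaction Fast, J); (Rarefaction Slow, M3);
          (LeftCharSlowShock, M)] ->
    transitional_rarefaction mu U J M
      [:: (Rarefaction Fast, J); (Rarefaction Slow, M3);
          (LeftCharSlowShock, M)].

(* Main.v *)
Require Import Defs.
From mathcomp Require Import all_boot all_order all_algebra.
From mathcomp Require Import all_classical all_reals all_analysis.
From mathcomp Require Import ring lra.

(** On an invariant line the system becomes scalar.  In the coordinate s (the
    effective saturation) and with n = nu < 1, the flux maps the state of
    coordinate s to the state of coordinate f(s) = s^2 / E(s), where
    E(s) = s^2 + n (1 - s)^2 ([flux_line]).  At a state of the line DF has two
    explicit eigenvectors: the direction of the line, with eigenvalue f'(s), and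
    the direction that exchanges the two phases other than the one of the
    vertex, with eigenvalue 2 s / E(s).  For s > 0 the second eigenvalue
    minus the first has the sign of s - u, where u = n / (1 + n) is the
    coordinate of the umbilic point.  Hence f' is the fast speed before the
    umbilic point and the slow speed after it ([lambda_line_fast],
    [lambda_line_slow]): a motion along the line with speed f' changes family
    exactly there.

    Rarefactions.  The sign of f'' is that of the cubic 2 s^3 - 3 s^2 + u, so
    that f' increases strictly on [0, si], with si the inflection.  The inverse
    function of f' gives the profile of every rarefaction between two states of
    this range ([rarefaction_line]); both pieces U -> umbilic and umbilic -> M
    (or M3) are of this kind, since u < si when n < 1.

    Shock.  The tangent to the graph of f at a meets the graph again at b if and
    only if a^2 + 2 b a (1 - a) = u ([secant_tangent]).  For b beyond the
    inflection and b <= 1/2 the left-hand side minus u is nonpositive at a = u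
    and positive at a = si, which yields M3 ([tangency_foot]).  The conditions
    on the speeds follow from the tangency equation.  The differential equation
    of the viscous profile preserves the line, where it reads
    s' = K (s - a)^2 (b - s) / E(s) ([profile_rhs]); its right-hand side is
    positive between a and b, and it is integrated in closed form
    ([connecting_orbit]). *)

Set Implicit Arguments.
Unset Strict Implicit.
Unset Printing Implicit Defensive.

Import Order.TTheory GRing.Theory Num.Theory.
Import numFieldNormedType.Exports.

Local Open Scope ring_scope.

(** * Inverse functions *)

(** The derivative of g is only known inside the interval, and h is claimed to
    be continuous up to the ends: g may have a critical point there, as [rspeed]
    does at the inflection, and then the derivative of h blows up. *)
Lemma increasing_inverse (R : realType) (g dg : R -> R) (a b : R) :
  a <= b -> (forall x, a < x < b -> is_derive x (1 : R) g (dg x) /\ 0 < dg x) ->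
  {within `[a, b], continuous g}%classic ->
  g a <= g b /\
  exists h : R -> R, [/\ h (g a) = a, h (g b) = b,
    {within `[g a, g b], continuous h}%classic &
    forall y, g a < y < g b ->
      [/\ a < h y < b, g (h y) = y & is_derive y (1 : R) h (dg (h y))^-1]].
Proof.
move=> ab gP gc.
have gmono : {in `[a, b] &, {homo g : x y / x < y}}.
  apply: gtr0_derive1_lt_cc => // x; rewrite in_itv/= => /gP[[dx ex] dgx] //.
  by rewrite derive1E ex.
have aI : a \in `[a, b] by rewrite in_itv/= lexx.
have bI : b \in `[a, b] by rewrite in_itv/= lexx ab.
have gab : g a <= g b.
  by move: ab; rewrite le_eqVlt => /predU1P[->//|/(gmono _ _ aI bI)/ltW].
split=> //.
have glt : {in `[a, b] &, {mono g : x y / x < y}}.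
  exact: (leW_mono_in (le_mono_in gmono)).
pose h y := xget a [set s | a <= s <= b /\ g s = y]%classic.
have gK : {in `[a, b], cancel g h}.
  move=> x xI; rewrite /h; case: xgetP => [s _ [sI gsx]|/(_ x)]; last first.
    by case; split=> //; rewrite -in_itv.
  by apply: (inc_inj_in (le_mono_in gmono)) => //; rewrite in_itv.
have hc : {within `[g a, g b], continuous h}%classic.
  exact: segment_can_le_continuous.
exists h; split => //; [exact: gK|exact: gK|move=> y /andP[ay yb]].
have [|x xI gxy] := IVT (v := y) ab gc.
  by rewrite min_l// max_r// !ltW.
have /andP[ax xb] : a < x < b.
  by rewrite -(glt _ _ aI xI) -(glt _ _ xI bI) gxy ay yb.
rewrite -gxy gK//; split=> //; first by rewrite ax xb.
have xo : x \in `]a, b[ by rewrite in_itv/= ax xb.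
have [dx dx0] := gP x (introT andP (conj ax xb)).
apply: (@is_derive_inverse R g h (dg x) x) => //; last by rewrite gt_eqF.
  near=> z; apply: gK; apply: subset_itv_oo_cc; near: z; exact: near_in_itvoo.
near=> z.
have : z \in `]a, b[ by near: z; exact: near_in_itvoo.
rewrite in_itv/= => /gP[[dz _] _].
exact/differentiable_continuous/derivable1_diffP.
Unshelve. all: by end_near. Qed.

(** The lower bound c on the derivative makes g onto: g moves by at least
    c (y - x) between x and y. *)
Lemma uniformly_increasing_inverse (R : realType) (g dg : R -> R) (c : R) :
  0 < c -> (forall x, is_derive x (1 : R) g (dg x)) -> (forall x, c <= dg x) ->
  exists h : R -> R, [/\ cancel h g,
    forall y, is_derive y (1 : R) h (dg (h y))^-1,
    (h y @[y --> +oo] --> +oo)%classic & (h y @[y --> -oo] --> -oo)%classic].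
Proof.
move=> c0 gP gc.
have gcont : continuous g.
  by move=> x; have [dx _] := gP x;
    exact/differentiable_continuous/derivable1_diffP.
have growth x y : x <= y -> c * (y - x) <= g y - g x.
  move=> xy; have [|z _ ->] := MVT_segment xy (fun z _ => gP z).
    exact: continuous_subspaceT.
  by rewrite ler_wpM2r// subr_ge0.
have gmono : {homo g : x y / x < y}.
  move=> x y xy; rewrite -subr_gt0 (lt_le_trans _ (growth _ _ (ltW xy)))//.
  by rewrite mulr_gt0// subr_gt0.
have gle := le_mono gmono.
have surj y : exists x, g x = y.
  (* Between 0 and k, and between - k and 0, g grows by at least |y - g 0|. *)
  pose k := `|y - g 0| / c.
  have k0 : 0 <= k by rewrite divr_ge0// ltW.
  have ck : c * k = `|y - g 0| by rewrite /k mulrC divfK// gt_eqF.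
  have := growth 0 k k0; rewrite subr0 ck => h1.
  have := growth (- k) 0; rewrite oppr_le0 sub0r opprK ck => /(_ k0) h2.
  have h3 := ler_norm (y - g 0).
  have h4 : - (y - g 0) <= `|y - g 0| by rewrite -normrN ler_norm.
  have h5 : g (- k) <= y by lra.
  have h6 : y <= g k by lra.
  have [|||x _ <-] := @IVT R g (- k) k y; last by exists x.
  - by rewrite (@le_trans _ _ 0)// oppr_le0.
  - exact: continuous_subspaceT.
  - by rewrite (min_l _) ?(max_r _) ?h5 ?(le_trans h5 h6).
pose h y := xget 0 [set x | g x = y]%classic.
have hK : cancel h g.
  move=> y; rewrite /h; case: xgetP => [//|].
  by have [x gx] := surj y => /(_ x).
have gK : cancel g h by apply: inj_can_sym hK _; exact: inc_inj gle.
exists h; split => //.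
- move=> y; have := @is_derive_inverse R g h (dg (h y)) (h y).
  rewrite hK; apply => //.
  + by near=> x; exact: gK.
  + by near=> x; exact: gcont.
  + by rewrite gt_eqF// (lt_le_trans c0).
- apply/cvgryPge => A; near=> y; rewrite -gle hK; near: y.
  exact/nbhs_pinfty_ge/num_real.
- apply/cvgrNyPle => A; near=> y; rewrite -gle hK; near: y.
  exact/nbhs_ninfty_le/num_real.
Unshelve. all: by end_near. Qed.

(** * The reduced flux *)

(** Up to the constant factor 1 / (mu alpha + mu beta), the total mobility at
    the state of effective saturation s of a line whose nu is n. *)
Definition rdenom (R : realType) (n s : R) : R := s ^+ 2 + n * (1 - s) ^+ 2.

Definition rflux (R : realType) (n s : R) : R := s ^+ 2 / rdenom n s.

(** The derivative of [rflux n], written out: the eigenvalue of DF whose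
    eigenvector is tangent to the line. *)
Definition rspeed (R : realType) (n s : R) : R :=
  2 * n * s * (1 - s) / rdenom n s ^+ 2.

(** The eigenvalue of DF whose eigenvector is transverse to the line. *)
Definition tspeed (R : realType) (n s : R) : R := 2 * s / rdenom n s.

(** For u = n / (1 + n), the second derivative of [rflux n] up to a positive
    factor. *)
Definition infl_cubic (R : realType) (u s : R) : R :=
  2 * s ^+ 3 - 3 * s ^+ 2 + u.

(** The minimum of the quadratic polynomial, attained at s = n / (1 + n). *)
Lemma rdenom_ge (R : realType) (n s : R) : 0 < n -> n / (1 + n) <= rdenom n s.
Proof.
move=> n0; rewrite ler_pdivrMr ?addr_gt0// -subr_ge0.
have -> : rdenom n s * (1 + n) - n = ((1 + n) * s - n) ^+ 2.
  by rewrite /rdenom; ring.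
exact: sqr_ge0.
Qed.

Lemma rdenom_gt0 (R : realType) (n s : R) : 0 < n -> 0 < rdenom n s.
Proof.
move=> n0; rewrite (lt_le_trans _ (rdenom_ge s n0))//.
by rewrite divr_gt0 ?addr_gt0.
Qed.

Lemma is_derive_rspeed (R : realType) (n s : R) : 0 < n ->
  is_derive s (1 : R) (rspeed n)
    (2 * n * (1 + n) / rdenom n s ^+ 3 * infl_cubic (n / (1 + n)) s).
Proof.
move=> n0; have E0 : rdenom n s ^+ 2 != 0.
  by rewrite expf_neq0// gt_eqF// rdenom_gt0.
have -> : rspeed n = (fun s => 2 * n * s * (1 - s)) \*
    (fun s => (rdenom n s ^+ 2)^-1) by [].
have dN : is_derive s (1 : R) (fun s : R => 2 * n * s * (1 - s))
    (2 * n * (1 - 2 * s)).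
  by apply: is_derive_eq; rewrite /GRing.scale/=; ring.
have dE : is_derive s (1 : R) (fun s : R => rdenom n s ^+ 2)
   (2 * rdenom n s * (2 * s - 2 * n * (1 - s))).
  rewrite /rdenom; apply: is_derive_eq; rewrite /GRing.scale/=; ring.
apply: is_derive_eq.
rewrite /GRing.scale/= /infl_cubic /rdenom; field.
by rewrite (gt_eqF (rdenom_gt0 s n0)) gt_eqF// addr_gt0.
Qed.

Lemma infl_cubic_decr (R : realType) (u x y : R) :
  0 <= x -> x < y -> y <= 1 -> infl_cubic u y < infl_cubic u x.
Proof.
move=> x0 xy y1; rewrite -subr_gt0 /infl_cubic.
have -> : 2 * x ^+ 3 - 3 * x ^+ 2 + u - (2 * y ^+ 3 - 3 * y ^+ 2 + u) =
  (y - x) * (2 * (x * (1 - x)) + 2 * (y * (1 - y)) + x * (1 - y) + y * (1 - x)).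
  by ring.
rewrite mulr_gt0 ?subr_gt0//.
have : 0 < y * (1 - x) by apply: mulr_gt0; lra.
have : 0 <= x * (1 - x) by apply: mulr_ge0; lra.
have : 0 <= y * (1 - y) by apply: mulr_ge0; lra.
have : 0 <= x * (1 - y) by apply: mulr_ge0; lra.
lra.
Qed.

Lemma infl_cubic_root (R : realType) (u : R) :
  0 <= u <= 1 -> exists s, 0 <= s <= 1 /\ infl_cubic u s = 0.
Proof.
move=> /andP[u0 u1]; have [|||s] := @IVT R (infl_cubic u) 0 1 0 => //.
- apply: continuous_subspaceT => x; apply/differentiable_continuous.
  by apply/derivable1_diffP; rewrite /infl_cubic; apply: ex_derive.
- rewrite /infl_cubic; apply/andP; split.
    by rewrite ge_min; apply/orP; right; lra.
  by rewrite le_max; apply/orP; left; lra.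
- by rewrite in_itv/= => s01 s0; exists s.
Qed.

Lemma infl_cubic_u (R : realType) (u : R) :
  0 < u -> u < 1 / 2 -> 0 < infl_cubic u u.
Proof.
move=> u0 u1; have -> : infl_cubic u u = u * ((1 - 2 * u) * (1 - u)).
  by rewrite /infl_cubic; ring.
by rewrite mulr_gt0// mulr_gt0//; lra.
Qed.

Lemma lt_inflection (R : realType) (u si : R) :
  0 < u -> u < 1 / 2 -> 0 <= si <= 1 -> infl_cubic u si = 0 -> u < si.
Proof.
move=> u0 u12 /andP[si0 _] si_root; have := infl_cubic_u u0 u12.
apply: contraTT; rewrite -!leNgt -si_root le_eqVlt => /predU1P[->//|siu].
by rewrite ltW// infl_cubic_decr//; lra.
Qed.

(** Intermediate value theorem for the tangency equation of [secant_tangent].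
    At a = u its two sides differ by - u (1 - 2 b) (1 - u), which is where the
    bound b <= 1 / 2 enters; at a = si the cubic equation turns the difference
    into 2 si (1 - si) (b - si). *)
Lemma tangency_foot (R : realType) (u si b : R) :
  0 < u -> u < 1 / 2 -> 0 <= si <= 1 -> infl_cubic u si = 0 ->
  si < b -> b <= 1 / 2 ->
  exists2 a, u <= a < si & a ^+ 2 + 2 * b * a * (1 - a) = u.
Proof.
move=> u0 u12 si01 si_root sib b12.
have usi := lt_inflection u0 u12 si01 si_root.
have /andP[si0 si1] := si01.
pose p (a : R) := a ^+ 2 + 2 * b * a * (1 - a) - u.
have pu : p u <= 0.
  have -> : p u = - (u * ((1 - 2 * b) * (1 - u))) by rewrite /p; ring.
  rewrite oppr_le0; apply: mulr_ge0; first exact: ltW.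
  by apply: mulr_ge0; lra.
have psi : 0 < p si.
  have -> : p si = 2 * (si * (1 - si)) * (b - si) - infl_cubic u si.
    by rewrite /p /infl_cubic; ring.
  by rewrite si_root subr0 !mulr_gt0 ?subr_gt0//; lra.
have [|||a] := @IVT R p u si 0.
- exact: ltW.
- apply: continuous_subspaceT => x; apply/differentiable_continuous.
  by apply/derivable1_diffP; rewrite /p; apply: ex_derive.
- by rewrite ge_min le_max pu (ltW psi) orbT.
rewrite in_itv/= => /andP[ua asi] pa0; exists a; first last.
  by move: pa0; rewrite /p; lra.
rewrite ua/= lt_neqAle asi andbT; apply/eqP => asi'.
by move: psi; rewrite -asi' pa0 ltxx.
Qed.

Lemma derive_rspeed_gt0 (R : realType) (n si : R) :
  0 < n -> 0 <= si <= 1 -> infl_cubic (n / (1 + n)) si = 0 ->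
  forall s, 0 <= s < si ->
  0 < 2 * n * (1 + n) / rdenom n s ^+ 3 * infl_cubic (n / (1 + n)) s.
Proof.
move=> n0 /andP[_ si1] si_root s /andP[s0 ssi].
rewrite mulr_gt0//; last by rewrite -si_root infl_cubic_decr.
by rewrite divr_gt0 ?exprn_gt0 ?rdenom_gt0// !mulr_gt0// addr_gt0.
Qed.

(** The two eigenvalues cross at s = n / (1 + n), the umbilic point; this is
    what makes the same motion along the line fast on one side and slow on the
    other. *)
Lemma tspeed_sub_rspeed (R : realType) (n s : R) : 0 < n ->
  tspeed n s - rspeed n s = 2 * s ^+ 2 * ((1 + n) * s - n) / rdenom n s ^+ 2.
Proof.
move=> n0; have := rdenom_gt0 s n0; rewrite /tspeed /rspeed /rdenom => E0.
by field; rewrite gt_eqF.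
Qed.

(** The tangent at a passes through the point of the graph at b exactly when the
    factor of degree two in a vanishes.  The double root b = a is factored
    out, which reduces the search for the left state of the shock to a quadratic
    equation. *)
Lemma secant_tangent (R : realType) (n a b : R) : 0 < n ->
  rflux n b - rflux n a - rspeed n a * (b - a) =
  n * (1 + n) * (b - a) ^+ 2 * (n / (1 + n) - (a ^+ 2 + 2 * b * a * (1 - a)))
  / (rdenom n a ^+ 2 * rdenom n b).
Proof.
move=> n0; have := rdenom_gt0 a n0; have := rdenom_gt0 b n0.
rewrite /rflux /rspeed /rdenom => Eb Ea.
have n1 : 0 < 1 + n by rewrite addr_gt0.
by field; rewrite !gt_eqF.
Qed.

(** [secant_tangent] at both ends: the tangency at a makes the error term at a
    vanish and gives a sign to the one at b. *)
Lemma shock_slower_behind (R : realType) (n a b : R) : 0 < n ->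
  0 < a -> a < b -> b < 1 ->
  a ^+ 2 + 2 * b * a * (1 - a) = n / (1 + n) -> rspeed n b < rspeed n a.
Proof.
move=> n0 a0 ab b1 tang.
have := secant_tangent a b n0; have := secant_tangent b a n0.
rewrite tang subrr mulr0 mul0r.
set K := _ / _ => sba sab.
have K0 : K < 0.
  rewrite /K pmulr_llt0; last first.
    by rewrite invr_gt0 mulr_gt0 ?exprn_gt0// rdenom_gt0.
  rewrite pmulr_rlt0; last first.
    by apply: mulr_gt0; [rewrite mulr_gt0 ?addr_gt0|
      rewrite exprn_even_gt0//= subr_eq0 lt_eqF].
  have -> : n / (1 + n) - (b ^+ 2 + 2 * a * b * (1 - b)) =
    - ((b - a) * (b * (1 - a) + a * (1 - b))) by rewrite -tang; ring.
  rewrite oppr_lt0 mulr_gt0 ?subr_gt0// addr_gt0// mulr_gt0//; lra.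
rewrite -subr_gt0 -(pmulr_lgt0 _ (x := b - a)) ?subr_gt0//.
lra.
Qed.

Lemma rflux_secant (R : realType) (n a b : R) : 0 < n ->
  rflux n b - rflux n a =
  n * (a + b - 2 * a * b) / (rdenom n a * rdenom n b) * (b - a).
Proof.
move=> n0; have := rdenom_gt0 a n0; have := rdenom_gt0 b n0.
rewrite /rflux /rdenom => Eb Ea.
by field; rewrite !gt_eqF.
Qed.

Lemma tangent_secant (R : realType) (n a b : R) : 0 < n ->
  a ^+ 2 + 2 * b * a * (1 - a) = n / (1 + n) ->
  rflux n b - rflux n a = rspeed n a * (b - a).
Proof.
move=> n0 tang; apply/eqP; rewrite -subr_eq0 secant_tangent// tang.
by rewrite subrr mulr0 mul0r.
Qed.

(** Being tangent at a, the shock has as speed the slope of the secant, which is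
    compared with [tspeed n b] over a common denominator; the numerator of the
    difference is affine in b with positive slope, and nonnegative at b = a,
    both because a is not before the umbilic point. *)
Lemma shock_faster_ahead (R : realType) (n a b : R) : 0 < n ->
  0 < a -> a < b -> n / (1 + n) <= a ->
  a ^+ 2 + 2 * b * a * (1 - a) = n / (1 + n) -> rspeed n a < tspeed n b.
Proof.
move=> n0 a0 ab; rewrite ler_pdivrMr ?addr_gt0// => ua tang.
have := tangent_secant n0 tang; rewrite rflux_secant// => /mulIf <-; last first.
  by rewrite subr_eq0 gt_eqF.
have Ea := rdenom_gt0 a n0; have Eb := rdenom_gt0 b n0.
rewrite -subr_gt0 /tspeed.
have -> : 2 * b / rdenom n b -
    n * (a + b - 2 * a * b) / (rdenom n a * rdenom n b) =
  ((b - a) * (2 * a * (a * (1 + n) - n) + n) + 2 * a ^+ 2 * (a * (1 + n) - n))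
    / (rdenom n a * rdenom n b).
  rewrite /rdenom in Ea Eb *.
  by field; rewrite !gt_eqF.
rewrite divr_gt0 ?mulr_gt0// ltr_pwDl//.
  rewrite mulr_gt0 ?subr_gt0// ltr_wpDl// mulr_ge0 ?subr_ge0// mulr_ge0// ltW//.
by rewrite mulr_ge0 ?subr_ge0// mulr_ge0 ?sqr_ge0.
Qed.

(** The left-hand side times [rdenom n s] is a cubic polynomial in s with a
    double root at a, by tangency, and a simple root at b. *)
Lemma profile_rhs (R : realType) (n a b s : R) : 0 < n ->
  a ^+ 2 + 2 * b * a * (1 - a) = n / (1 + n) ->
  rflux n s - rflux n a - rspeed n a * (s - a) =
  rspeed n a * (1 + n) * (s - a) ^+ 2 * (b - s) / rdenom n s.
Proof.
move=> n0 tang; rewrite secant_tangent// -tang.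
have Ea := rdenom_gt0 a n0; have Es := rdenom_gt0 s n0.
rewrite /rspeed; rewrite /rdenom in Ea Es *.
by field; rewrite !gt_eqF.
Qed.

(** * The scalar viscous profile *)

(** In the variable r with s = (a + b e^r) / (1 + e^r), which maps the real line
    onto the interval from a to b, the equation separates into dt = T'(r) dr
    with T elementary.  As T' is bounded below by a positive constant, T is a
    bijection of the real line, and s is obtained by following the inverse
    of T. *)
Lemma connecting_orbit (R : realType) (n K a b : R) :
  0 < n -> 0 < K -> a < b ->
  exists s : R -> R, [/\ forall t, a < s t < b,
    forall t, is_derive t (1 : R) s
      (K * (s t - a) ^+ 2 * (b - s t) / rdenom n (s t)),
    (s t @[t --> -oo] --> a)%classic & (s t @[t --> +oo] --> b)%classic].
Proof.
move=> n0 K0 ab; have ba0 : 0 < b - a by rewrite subr_gt0.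
(* The polynomial (1 + e^r)^2 rdenom n (S r) in e^r is
   rdenom n a + 2 G e^r + rdenom n b e^(2 r). *)
pose G := a * b + n * (1 - a) * (1 - b).
pose T (r : R) := ((- rdenom n a * expR (- r) + (2 * G - rdenom n a) * r)
  / (b - a) ^+ 2 + (1 + n) * ln (1 + expR r)) / K.
pose S (r : R) := b - (b - a) / (1 + expR r).
pose dT (r : R) := rdenom n (S r) * (1 + expR (- r)) / (K * (b - a) ^+ 2).
have x0 (r : R) : 0 < 1 + expR r by rewrite addr_gt0 ?expR_gt0.
have d1 (r : R) : is_derive r (1 : R) (fun r => 1 + expR r) (expR r).
  by apply: is_derive_eq; rewrite add0r mul1r.
have TP (r : R) : is_derive r (1 : R) T (dT r).
  have ? : is_derive r (1 : R) (fun r => ln (1 + expR r))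
      (expR r / (1 + expR r)).
    have := @is_derive1_comp R (@ln R) _ r _ _ (is_derive1_ln (x0 r)) (d1 r).
    by rewrite mulrC.
  rewrite /T; apply: is_derive_eq.
  rewrite /dT /S /G /rdenom /GRing.scale/= expRN; field.
  by rewrite !gt_eqF ?expR_gt0.
have SP (r : R) : is_derive r (1 : R) S ((b - a) * expR r / (1 + expR r) ^+ 2).
  have ? := @is_deriveV R (fun r => 1 + expR r) r _ _ (lt0r_neq0 (x0 r)) (d1 r).
  rewrite /S; apply: is_derive_eq.
  rewrite /GRing.scale/=; field.
  by rewrite gt_eqF.
have dT_ge (r : R) : n / (1 + n) / (K * (b - a) ^+ 2) <= dT r.
  rewrite /dT ler_pM2r ?invr_gt0 ?mulr_gt0 ?exprn_gt0//.
  rewrite (le_trans (rdenom_ge (S r) n0))// ler_peMr ?lerDl ?expR_ge0//.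
  exact/ltW/rdenom_gt0.
have [|h [hK hP hy hNy]] := uniformly_increasing_inverse _ TP dT_ge.
  by rewrite divr_gt0 ?divr_gt0 ?addr_gt0// mulr_gt0// exprn_gt0.
have expNy : (expR r @[r --> -oo] --> (0 : R))%classic.
  exact/cvgNy_compNP/cvgr_expR.
have Sa : (S r @[r --> -oo] --> a)%classic.
  have -> : a = b - (b - a) / (1 + 0) by rewrite addr0 divr1 subKr.
  apply: cvgB; first exact: cvg_cst.
  apply: cvgM; first exact: cvg_cst.
  apply: cvgV; first by rewrite addr0 oner_neq0.
  by apply: cvgD => //; exact: cvg_cst.
have Sb : (S r @[r --> +oo] --> b)%classic.
  have -> : S = (fun r => b - (b - a) * expR (- r) / (1 + expR (- r))).
    apply/funext => r; rewrite /S expRN; field.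
    by rewrite addrC !gt_eqF ?expR_gt0.
  suff /cvg_trans : (b - (b - a) * expR (- r) / (1 + expR (- r))
      @[r --> +oo] --> b - (b - a) * 0 / (1 + 0))%classic.
    by rewrite mulr0 mul0r subr0; apply.
  apply: cvgB; first exact: cvg_cst.
  apply: cvgM.
    by apply: cvgM; [exact: cvg_cst|exact: cvgr_expR].
  apply: cvgV; first by rewrite addr0 oner_neq0.
  by apply: cvgD; [exact: cvg_cst|exact: cvgr_expR].
exists (S \o h); split.
- move=> t /=; have bS : b - S (h t) = (b - a) / (1 + expR (h t)).
    by rewrite /S; ring.
  have Sa' : S (h t) - a = (b - a) * expR (h t) / (1 + expR (h t)).
    by rewrite /S; field; rewrite gt_eqF.
  rewrite -subr_gt0 -[S (h t) < b]subr_gt0 bS Sa' !divr_gt0//.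
  by rewrite mulr_gt0 ?expR_gt0.
- move=> t; have Pt := hP t; have PS := SP (h t).
  apply: is_derive_eq.
  have := rdenom_gt0 (S (h t)) n0; rewrite /dT expRN /=.
  set D := rdenom _ _ => D0; rewrite /S; field.
  by rewrite !gt_eqF ?expR_gt0.
- exact: cvg_comp hNy Sa.
- exact: cvg_comp hy Sb.
Qed.

(** * Invariant lines *)

Definition vertex (R : realType) (c : phase) : 'rV[R]_2 :=
  match c with
  | Water => state_of 1 0
  | Oil => state_of 0 1
  | Gas => state_of 0 0
  end.

(** The derivative of the state with respect to the effective saturation: the
    saturation of the phase of the vertex decreases at unit rate, and the other
    two increase in proportion to their viscosities. *)
Definition line_dir (R : realType) (mu : phase -> R) (c : phase) : 'rV[R]_2 :=
  match c with
  | Water => state_of (-1) (mu Oil / (mu Oil + mu Gas))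
  | Oil => state_of (mu Water / (mu Water + mu Gas)) (-1)
  | Gas => state_of (mu Water / (mu Water + mu Oil))
                    (mu Oil / (mu Water + mu Oil))
  end.

(** An exchange of the two phases other than that of the vertex; the total
    mobility is stationary in this direction along the line. *)
Definition trans_dir (R : realType) (c : phase) : 'rV[R]_2 :=
  match c with
  | Water => state_of 0 1
  | Oil => state_of 1 0
  | Gas => state_of 1 (-1)
  end.

Definition line_state (R : realType) (mu : phase -> R) (c : phase) (s : R) :
  'rV[R]_2 := vertex R c + s *: line_dir mu c.

Lemma row2P (R : realType) (A B : 'rV[R]_2) :
  A ord0 ord0 = B ord0 ord0 -> A ord0 ord_max = B ord0 ord_max -> A = B.
Proof.
move=> h0 h1; apply/rowP => i.
have [->|->] : i = ord0 \/ i = ord_max.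
  by case: i => -[|[|//]] ?; [left|right]; apply: val_inj.
- exact: h0.
- exact: h1.
Qed.

Lemma sat_line (R : realType) (mu : phase -> R) (c p : phase) (s : R) :
  (forall p, 0 < mu p) ->
  sat p (line_state mu c s) =
  match c, p with
  | Water, Water | Oil, Oil | Gas, Gas => 1 - s
  | _, _ => s * mu p / (mu (alpha c) + mu (beta c))
  end.
Proof.
move=> mu0; have W := mu0 Water; have O := mu0 Oil; have G := mu0 Gas.
by case: c; case: p; rewrite /sat /line_state /= !mxE /=; field;
  rewrite ?gt_eqF ?addr_gt0.
Qed.

Lemma proportional_split (R : realType) (x y m k : R) : 0 < m -> 0 < k ->
  x / m = y / k -> x = (x + y) * (m / (m + k)) /\ y = (x + y) * (k / (m + k)).
Proof.
move=> m0 k0 /(congr1 (fun z => z * m)); rewrite divfK ?gt_eqF// => ->.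
by split; field; rewrite !gt_eqF ?addr_gt0.
Qed.

Lemma line_state_eff_sat (R : realType) (mu : phase -> R) (c : phase) U :
  (forall p, 0 < mu p) -> invariant_line mu c U ->
  U = line_state mu c (eff_sat c U).
Proof.
move=> mu0 [_ /(proportional_split (mu0 _) (mu0 _))].
rewrite /eff_sat; case: c => /= -[e1 e2]; apply: row2P;
  rewrite /line_state/= !mxE/= ?mulr1 ?mulrN1 ?addr0 ?add0r//; ring.
Qed.

Lemma eff_sat_line (R : realType) (mu : phase -> R) (c : phase) (s : R) :
  (forall p, 0 < mu p) -> eff_sat c (line_state mu c s) = s.
Proof.
move=> mu0; have W := mu0 Water; have O := mu0 Oil; have G := mu0 Gas.
by rewrite /eff_sat !sat_line//; case: c => /=; field; rewrite gt_eqF ?addr_gt0.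
Qed.

Lemma triangle_line (R : realType) (mu : phase -> R) (c : phase) (s : R) :
  (forall p, 0 < mu p) -> 0 <= s <= 1 -> triangle (line_state mu c s).
Proof.
move=> mu0 /andP[s0 s1] p; rewrite sat_line//.
have mu_ge0 q : 0 <= mu q by exact: ltW.
by case: c; case: p; rewrite ?subr_ge0// divr_ge0 ?mulr_ge0 ?addr_ge0.
Qed.

Lemma invariant_line_state (R : realType) (mu : phase -> R) (c : phase)
    (s : R) :
  (forall p, 0 < mu p) -> 0 <= s <= 1 ->
  invariant_line mu c (line_state mu c s).
Proof.
move=> mu0 s01; split; first exact: triangle_line.
have W := mu0 Water; have O := mu0 Oil; have G := mu0 Gas.
by rewrite !sat_line//; case: c => /=; field; rewrite !gt_eqF ?addr_gt0.
Qed.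

Lemma nu_gt0 (R : realType) (mu : phase -> R) (c : phase) :
  (forall p, 0 < mu p) -> 0 < nu mu c.
Proof. by move=> mu0; rewrite /nu divr_gt0 ?addr_gt0. Qed.

Lemma umbilic_line (R : realType) (mu : phase -> R) (c : phase) :
  (forall p, 0 < mu p) ->
  umbilic mu = line_state mu c (nu mu c / (1 + nu mu c)).
Proof.
move=> mu0; have W := mu0 Water; have O := mu0 Oil; have G := mu0 Gas.
rewrite /nu; case: c => /=; apply: row2P;
  rewrite /umbilic /line_state !mxE/=; field;
  by rewrite !gt_eqF ?addr_gt0.
Qed.

Definition mobility (R : realType) (mu : phase -> R) (U : 'rV[R]_2) : R :=
  sat Water U ^+ 2 / mu Water + sat Oil U ^+ 2 / mu Oil
  + sat Gas U ^+ 2 / mu Gas.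

Lemma mobility_line (R : realType) (mu : phase -> R) (c : phase) (s : R) :
  (forall p, 0 < mu p) ->
  mobility mu (line_state mu c s) =
  rdenom (nu mu c) s / (mu (alpha c) + mu (beta c)).
Proof.
move=> mu0; have W := mu0 Water; have O := mu0 Oil; have G := mu0 Gas.
rewrite /mobility !sat_line// /rdenom /nu; case: c => /=; field;
  by rewrite !gt_eqF ?addr_gt0.
Qed.

Lemma mobility_line_gt0 (R : realType) (mu : phase -> R) (c : phase) (s : R) :
  (forall p, 0 < mu p) -> 0 < mobility mu (line_state mu c s).
Proof.
by move=> mu0; rewrite mobility_line// divr_gt0 ?rdenom_gt0 ?nu_gt0// addr_gt0.
Qed.

(** On the line each fractional flow is the saturation at another state of the
    same line: the line is invariant. *)
Lemma frac_flow_line (R : realType) (mu : phase -> R) (c p : phase) (s : R) :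
  (forall p, 0 < mu p) ->
  frac_flow mu p (line_state mu c s) =
  sat p (line_state mu c (rflux (nu mu c) s)).
Proof.
move=> mu0; have W := mu0 Water; have O := mu0 Oil; have G := mu0 Gas.
rewrite /frac_flow -/(mobility mu _) mobility_line// !sat_line//.
have E0 := rdenom_gt0 s (nu_gt0 c mu0); rewrite /rflux.
(* For the phase of the vertex, whose saturation is 1 - s. *)
have -> : 1 - s ^+ 2 / rdenom (nu mu c) s =
   nu mu c * (1 - s) ^+ 2 / rdenom (nu mu c) s.
  rewrite /rdenom in E0 *; field; by rewrite gt_eqF.
move: E0; set D := rdenom _ _ => E0.
rewrite /nu; case: c D E0; case: p => /= D E0; field;
  by rewrite !gt_eqF ?addr_gt0.
Qed.

Lemma flux_line (R : realType) (mu : phase -> R) (c : phase) (s : R) :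
  (forall p, 0 < mu p) ->
  flux mu (line_state mu c s) = line_state mu c (rflux (nu mu c) s).
Proof.
by move=> mu0; apply: row2P; rewrite /flux [LHS]mxE/= frac_flow_line.
Qed.

Lemma line_stateB (R : realType) (mu : phase -> R) (c : phase) (s t : R) :
  line_state mu c s - line_state mu c t = (s - t) *: line_dir mu c.
Proof. by rewrite /line_state opprD addrACA subrr add0r scalerBl. Qed.

(** * The differential of the flux and its eigenvalues on a line *)

(** The linear part of the affine function [sat p]. *)
Definition dsat (R : realType) (p : phase) (v : 'rV[R]_2) : R :=
  match p with
  | Water => v ord0 ord0
  | Oil => v ord0 ord_max
  | Gas => - v ord0 ord0 - v ord0 ord_max
  end.

Lemma differentiable_sat (R : realType) (p : phase) (U : 'rV[R]_2) :
  differentiable (@sat R p) U.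
Proof.
case: p => /=; [exact: differentiable_coord|exact: differentiable_coord|].
apply: differentiableB; last exact: differentiable_coord.
by apply: differentiableB => //; exact: differentiable_coord.
Qed.

Lemma is_derive_sat (R : realType) (p : phase) (U v : 'rV[R]_2) :
  is_derive U v (@sat R p) (dsat p v).
Proof.
have lim : (h^-1 *: (sat p (h *: v + U) - sat p U)
    @[h --> 0^'] --> dsat p v)%classic.
  apply: cvg_trans (@cvg_cst _ (dsat p v) R (0^')%classic _).
  apply: near_eq_cvg.
  near=> h.
  have h0 : h != 0 by near: h; exact: nbhs_dnbhs_neq.
  by case: p; rewrite /GRing.scale /= !mxE; field.
by split; [apply/cvg_ex; exists (dsat p v)|exact/cvg_lim].
Unshelve. all: by end_near. Qed.

Lemma differentiable_flux (R : realType) (mu : phase -> R) (U : 'rV[R]_2) :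
  mobility mu U != 0 -> differentiable (flux mu) U.
Proof.
move=> D0.
have dX p : differentiable (fun V => sat p V ^+ 2) U.
  exact: (@differentiableX _ _ (@sat R p) 1 U (differentiable_sat p U)).
have dff p : differentiable (frac_flow mu p) U.
  apply: differentiableM.
    exact: differentiableM.
  apply: differentiableV => //.
  do 2?apply: differentiableD; exact: differentiableM.
have -> : flux mu =
    (fun U => frac_flow mu Water U *: (state_of 1 0 : 'rV[R]_2)) \+
    (fun U => frac_flow mu Oil U *: (state_of 0 1 : 'rV[R]_2)).
  apply/funext => V; apply: row2P;
    by rewrite !mxE/= ?mulr1 ?mulr0 ?addr0 ?add0r.
by apply: differentiableD; apply: differentiableZl.
Qed.

Definition dmobility (R : realType) (mu : phase -> R) (U v : 'rV[R]_2) : R :=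
  2 * (sat Water U * dsat Water v / mu Water + sat Oil U * dsat Oil v / mu Oil
       + sat Gas U * dsat Gas v / mu Gas).

Definition dfrac_flow (R : realType) (mu : phase -> R) (p : phase)
    (U v : 'rV[R]_2) : R :=
  2 * sat p U * dsat p v / mu p / mobility mu U
  - sat p U ^+ 2 / mu p * dmobility mu U v / mobility mu U ^+ 2.

Lemma is_derive_sqr_div (R : realType) (V : normedModType R) (f : V -> R)
    (x v : V) (d m : R) :
  is_derive x v f d -> is_derive x v (fun y => f y ^+ 2 / m) (2 * f x * d / m).
Proof. by move=> df; apply: is_derive_eq; rewrite /GRing.scale/=; ring. Qed.

Lemma is_derive_mobility (R : realType) (mu : phase -> R) (U v : 'rV[R]_2) :
  is_derive U v (mobility mu) (dmobility mu U v).
Proof.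
have ds p := is_derive_sqr_div (mu p) (@is_derive_sat R p U v).
apply: is_derive_eq (is_deriveD (is_deriveD (ds Water) (ds Oil)) (ds Gas)) _.
rewrite /dmobility; ring.
Qed.

Lemma derive_frac_flow (R : realType) (mu : phase -> R) (p : phase)
    (U v : 'rV[R]_2) :
  mobility mu U != 0 -> 'D_v (frac_flow mu p) U = dfrac_flow mu p U v.
Proof.
move=> M0; have ds := is_derive_sqr_div (mu p) (@is_derive_sat R p U v).
have dM := @is_derive_mobility R mu U v.
have -> : frac_flow mu p =
  (fun U => sat p U ^+ 2 / mu p) \* (fun U => (mobility mu U)^-1) by [].
rewrite deriveM; last 2 first.
- by apply: ex_derive.
- by apply: derivableV.
rewrite deriveV// !derive_val /dfrac_flow /GRing.scale/=.
by move: (mu p)^-1 => m; field.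
Qed.

Lemma mul_DF (R : realType) (mu : phase -> R) (U v : 'rV[R]_2) :
  mobility mu U != 0 ->
  v *m DF mu U = state_of (dfrac_flow mu Water U v) (dfrac_flow mu Oil U v).
Proof.
move=> M0; have dF := differentiable_flux M0.
rewrite /DF -deriveEjacobian// derive_mx; last exact: diff_derivable.
apply: row2P; rewrite !mxE/= -derive_frac_flow//.
  by congr ('D_v _ U); apply/funext => V; rewrite !mxE.
by congr ('D_v _ U); apply/funext => V; rewrite !mxE.
Qed.

Lemma DF_line_dir (R : realType) (mu : phase -> R) (c : phase) (s : R) :
  (forall p, 0 < mu p) ->
  line_dir mu c *m DF mu (line_state mu c s) =
  rspeed (nu mu c) s *: line_dir mu c.
Proof.
move=> mu0; have W := mu0 Water; have O := mu0 Oil; have G := mu0 Gas.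
have M0 := mobility_line_gt0 c s mu0.
have E0 := rdenom_gt0 s (nu_gt0 c mu0).
have pos p q r : s ^+ 2 * mu p + (mu q + mu r) * (1 - s) ^+ 2 != 0.
  have qr0 : 0 < (mu q + mu r) / mu p by rewrite divr_gt0 ?addr_gt0.
  have -> : s ^+ 2 * mu p + (mu q + mu r) * (1 - s) ^+ 2 =
      mu p * rdenom ((mu q + mu r) / mu p) s.
    by rewrite /rdenom; field; rewrite gt_eqF.
  by rewrite gt_eqF// mulr_gt0// rdenom_gt0.
rewrite mul_DF ?gt_eqF// /dfrac_flow mobility_line//.
have -> : dmobility mu (line_state mu c s) (line_dir mu c) =
    2 * (s - nu mu c * (1 - s)) / (mu (alpha c) + mu (beta c)).
  rewrite /dmobility !sat_line// /nu.
  case: c {M0 E0} => /=; rewrite !mxE/=; field;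
   by rewrite !gt_eqF ?addr_gt0.
rewrite !sat_line// /rspeed /rdenom /nu in E0 *.
case: c E0 {M0} => /= E0; apply: row2P; rewrite !mxE/=; field;
  by rewrite pos !gt_eqF ?addr_gt0.
Qed.

Lemma DF_trans_dir (R : realType) (mu : phase -> R) (c : phase) (s : R) :
  (forall p, 0 < mu p) ->
  trans_dir R c *m DF mu (line_state mu c s) =
  tspeed (nu mu c) s *: trans_dir R c.
Proof.
move=> mu0; have W := mu0 Water; have O := mu0 Oil; have G := mu0 Gas.
have M0 := mobility_line_gt0 c s mu0.
have E0 := rdenom_gt0 s (nu_gt0 c mu0).
rewrite mul_DF ?gt_eqF// /dfrac_flow mobility_line//.
(* The two varying terms of the mobility cancel, s_i / mu_i being the same for
   both phases on the line. *)
have -> : dmobility mu (line_state mu c s) (trans_dir R c) = 0.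
  rewrite /dmobility !sat_line//; case: c {M0 E0} => /=; rewrite !mxE/=; field;
   by rewrite !gt_eqF ?addr_gt0.
rewrite mulr0 mul0r subr0 !mulr0 !mul0r.
rewrite !sat_line// /tspeed.
move: E0; set E := rdenom _ _.
by case: c E {M0} => /= E E0; apply: row2P; rewrite !mxE/=; field;
   rewrite ?gt_eqF ?addr_gt0.
Qed.

Lemma trans_dir_neq0 (R : realType) (c : phase) : trans_dir R c != 0.
Proof.
apply/eqP => /rowP h; have := h ord0; have := h ord_max.
by case: c {h}; rewrite !mxE/= => /eqP + /eqP; rewrite ?oner_eq0.
Qed.

Lemma dir_decomposition (R : realType) (mu : phase -> R) (c : phase)
    (v : 'rV[R]_2) : (forall p, 0 < mu p) ->
  exists x y, v = x *: line_dir mu c + y *: trans_dir R c.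
Proof.
move=> mu0; have W := mu0 Water; have O := mu0 Oil; have G := mu0 Gas.
set v0 := v ord0 ord0; set v1 := v ord0 ord_max.
exists (match c with Water => - v0 | Oil => - v1 | Gas => v0 + v1 end).
exists (match c with
  | Water => v1 + v0 * (mu Oil / (mu Oil + mu Gas))
  | Oil => v0 + v1 * (mu Water / (mu Water + mu Gas))
  | Gas => v0 - (v0 + v1) * (mu Water / (mu Water + mu Oil))
  end).
by case: c; apply: row2P; rewrite !mxE/= -/v0 -/v1; field;
  rewrite ?gt_eqF ?addr_gt0.
Qed.

Lemma line_dir_neq0 (R : realType) (mu : phase -> R) (c : phase) :
  (forall p, 0 < mu p) -> line_dir mu c != 0.
Proof.
move=> mu0; apply/eqP => d0; have := eff_sat_line c 1 mu0.
have := eff_sat_line c 0 mu0; rewrite /line_state d0 !scaler0 => -> /eqP.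
by rewrite eq_sym oner_eq0.
Qed.

(** The two directions span the plane, so that the product of DF - rspeed and
    DF - tspeed vanishes on every vector; evaluated on an eigenvector this
    leaves only two possible eigenvalues.  It also covers the umbilic point,
    where both coincide. *)
Lemma eigenvalue_DF_line (R : realType) (mu : phase -> R) (c : phase)
    (s l : R) :
  (forall p, 0 < mu p) ->
  eigenvalue (DF mu (line_state mu c s)) l <->
  l = rspeed (nu mu c) s \/ l = tspeed (nu mu c) s.
Proof.
move=> mu0.
have hd := DF_line_dir c s mu0; have ht := DF_trans_dir c s mu0.
split=> [/eigenvalueP[v vl v0]|].
  have [x [y vE]] := dir_decomposition c v mu0.
  set A := DF _ _ in hd ht vl; set r := rspeed _ _ in hd *.
  set t := tspeed _ _ in ht *.
  have vA : v *m A = (x * r) *: line_dir mu c + (y * t) *: trans_dir R c.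
    by rewrite {1}vE mulmxDl -!scalemxAl hd ht !scalerA.
  have vAA : v *m A *m A =
      (x * r * r) *: line_dir mu c + (y * t * t) *: trans_dir R c.
    by rewrite vA mulmxDl -!scalemxAl hd ht !scalerA.
  have : ((l - r) * (l - t)) *: v = 0.
    have -> : ((l - r) * (l - t)) *: v =
        v *m A *m A - (r + t) *: (v *m A) + (r * t) *: v.
      rewrite vl -scalemxAl vl !scalerA -scalerBl -scalerDl.
      by congr (_ *: _); ring.
    rewrite vAA vA vE; apply/rowP => i; rewrite !mxE; ring.
  move=> /eqP; rewrite scaler_eq0 (negbTE v0) orbF mulf_eq0 !subr_eq0.
  by case/orP => /eqP ->; [left|right].
case=> ->; apply/eigenvalueP.
  by exists (line_dir mu c) => //; exact: line_dir_neq0.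
by exists (trans_dir R c) => //; exact: trans_dir_neq0.
Qed.

Lemma lambda_line (R : realType) (mu : phase -> R) (c : phase) (s : R) :
  (forall p, 0 < mu p) ->
  lambda mu Slow (line_state mu c s) =
    Num.min (rspeed (nu mu c) s) (tspeed (nu mu c) s) /\
  lambda mu Fast (line_state mu c s) =
    Num.max (rspeed (nu mu c) s) (tspeed (nu mu c) s).
Proof.
move=> mu0; rewrite /lambda.
have -> : [set l | eigenvalue (DF mu (line_state mu c s)) l]%classic =
  [set rspeed (nu mu c) s; tspeed (nu mu c) s]%classic.
  by apply/seteqP; split=> l /=; rewrite eigenvalue_DF_line.
move: (rspeed _ _) (tspeed _ _) => r t; split.
  apply/eqP; rewrite eq_le; apply/andP; split.
    rewrite le_min; apply/andP; split; apply: ge_inf; [|by left| |by right];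
    by exists (Num.min r t) => _ [->|->]; rewrite ge_min lexx ?orbT.
  apply: lb_le_inf; first by exists r; left.
  by move=> _ [->|->]; rewrite ge_min lexx ?orbT.
apply/eqP; rewrite eq_le; apply/andP; split.
  apply: ge_sup; first by exists r; left.
  by move=> _ [->|->]; rewrite le_max lexx ?orbT.
rewrite ge_max; apply/andP; split; apply: ub_le_sup; [|by left| |by right];
by exists (Num.max r t) => _ [->|->]; rewrite le_max lexx ?orbT.
Qed.

Lemma lambda_line_slow (R : realType) (mu : phase -> R) (c : phase) (s : R) :
  (forall p, 0 < mu p) -> nu mu c / (1 + nu mu c) <= s ->
  lambda mu Slow (line_state mu c s) = rspeed (nu mu c) s /\
  lambda mu Fast (line_state mu c s) = tspeed (nu mu c) s.
Proof.
move=> mu0; have n0 := nu_gt0 c mu0; rewrite ler_pdivrMr ?addr_gt0// => us.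
have [-> ->] := lambda_line c s mu0.
have rt : rspeed (nu mu c) s <= tspeed (nu mu c) s.
  rewrite -subr_ge0 tspeed_sub_rspeed// divr_ge0 ?sqr_ge0// mulr_ge0//.
    by rewrite mulr_ge0 ?sqr_ge0.
  by rewrite subr_ge0 mulrC.
by rewrite min_l// max_r.
Qed.

Lemma lambda_line_fast (R : realType) (mu : phase -> R) (c : phase) (s : R) :
  (forall p, 0 < mu p) -> s <= nu mu c / (1 + nu mu c) ->
  lambda mu Fast (line_state mu c s) = rspeed (nu mu c) s.
Proof.
move=> mu0; have n0 := nu_gt0 c mu0; rewrite ler_pdivlMr ?addr_gt0// => us.
have [_ ->] := lambda_line c s mu0.
rewrite max_l// -subr_le0 tspeed_sub_rspeed// pmulr_lle0; last first.
  by rewrite invr_gt0 exprn_gt0// rdenom_gt0.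
apply: mulr_ge0_le0; first by rewrite mulr_ge0 ?sqr_ge0.
by rewrite subr_le0 mulrC.
Qed.

(** * Waves along a line *)

Lemma line_state_continuous (R : realType) (mu : phase -> R) (c : phase) :
  continuous (line_state mu c).
Proof.
move=> s; apply: cvgD; first exact: cvg_cst.
by apply: cvgZr_tmp; exact: cvg_id.
Qed.

(** The difference quotient of a curve in the line is that of its coordinate
    times the constant direction. *)
Lemma is_derive_line_state (R : realType) (mu : phase -> R) (c : phase)
    (h : R -> R) (x d : R) : is_derive x (1 : R) h d ->
  is_derive x (1 : R) (line_state mu c \o h) (d *: line_dir mu c).
Proof.
move=> [hd <-].
have lim : (t^-1 *:
    ((line_state mu c \o h) (t *: 1 + x) - (line_state mu c \o h) x)
    @[t --> (0 : R)^'] --> 'D_1 h x *: line_dir mu c)%classic.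
  under eq_fun do rewrite /= line_stateB scalerA.
  by apply: cvgZr_tmp; exact: hd.
by split; [apply/cvg_ex; exists ('D_1 h x *: line_dir mu c)|exact/cvg_lim].
Qed.

(** Stated for the family whose speed is [rspeed] along the whole piece of line,
    so that it serves on both sides of the umbilic point. *)
Lemma rarefaction_line (R : realType) (mu : phase -> R) (c : phase)
    (i : wave_family) (a b si : R) :
  (forall p, 0 < mu p) ->
  0 <= a -> a <= b -> b <= si -> 0 <= si <= 1 ->
  infl_cubic (nu mu c / (1 + nu mu c)) si = 0 ->
  (forall s, a <= s <= b ->
     lambda mu i (line_state mu c s) = rspeed (nu mu c) s) ->
  rarefaction mu i (line_state mu c a) (line_state mu c b).
Proof.
move=> mu0 a0 ab bsi si01 si_root lamE; have n0 := nu_gt0 c mu0.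
have /andP[si0 si1] := si01; have b1 := le_trans bsi si1.
have lamA : lambda mu i (line_state mu c a) = rspeed (nu mu c) a.
  by rewrite lamE// lexx ab.
have lamB : lambda mu i (line_state mu c b) = rspeed (nu mu c) b.
  by rewrite lamE// lexx ab.
have gP (x : R) : a < x < b -> is_derive x (1 : R) (rspeed (nu mu c))
    (2 * nu mu c * (1 + nu mu c) / rdenom (nu mu c) x ^+ 3
      * infl_cubic (nu mu c / (1 + nu mu c)) x) /\
    0 < 2 * nu mu c * (1 + nu mu c) / rdenom (nu mu c) x ^+ 3
      * infl_cubic (nu mu c / (1 + nu mu c)) x.
  move=> /andP[ax xb]; split; first exact: is_derive_rspeed.
  apply: (derive_rspeed_gt0 n0 si01 si_root).
  by rewrite (le_trans a0 (ltW ax)) (lt_le_trans xb bsi).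
have [|lamAB [h [ha hb hc hP]]] := increasing_inverse ab gP.
  apply: continuous_subspaceT => x; apply/differentiable_continuous.
  by apply/derivable1_diffP; have [] := is_derive_rspeed x n0.
split; first by apply: triangle_line => //; rewrite a0 (le_trans ab b1).
split; first by apply: triangle_line => //; rewrite (le_trans a0 ab).
rewrite lamA lamB; split=> //.
exists (line_state mu c \o h); split; rewrite /= ?ha ?hb//.
  by move=> x; exact: cvg_comp (hc x) (@line_state_continuous R mu c (h x)).
move=> xi /hP[/andP[ahx hxb] hx dh].
have lamx : lambda mu i (line_state mu c (h xi)) = xi.
  by rewrite lamE ?(ltW ahx) ?ltW.
have [_ dg] := gP _ (introT andP (conj ahx hxb)).
have [dL eL] := is_derive_line_state mu c dh.
split=> //.
  apply: triangle_line => //.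
  by rewrite (le_trans a0 (ltW ahx)) (le_trans (ltW hxb) b1).
rewrite lamx derive1E eL; split.
  by rewrite scaler_eq0 negb_or line_dir_neq0// andbT invr_eq0 gt_eqF.
apply/eigenspaceP; rewrite -scalemxAl DF_line_dir// hx.
by rewrite !scalerA mulrC.
Qed.

Lemma shock_line (R : realType) (mu : phase -> R) (c : phase) (a b : R) :
  (forall p, 0 < mu p) ->
  nu mu c / (1 + nu mu c) <= a -> a < b -> b < 1 ->
  a ^+ 2 + 2 * b * a * (1 - a) = nu mu c / (1 + nu mu c) ->
  left_char_slow_shock mu (line_state mu c a) (line_state mu c b).
Proof.
move=> mu0 ua ab b1 tang; have n0 := nu_gt0 c mu0.
have a0 : 0 < a by rewrite (lt_le_trans _ ua)// divr_gt0// addr_gt0.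
have line_in x : a <= x <= b -> triangle (line_state mu c x).
  move=> /andP[ax xb]; apply: triangle_line => //.
  by rewrite (le_trans (ltW a0) ax) (le_trans xb (ltW b1)).
have [lsa _] := lambda_line_slow mu0 ua.
have [lsb lfb] := lambda_line_slow mu0 (le_trans ua (ltW ab)).
have RH : RH_speed mu (line_state mu c a) (line_state mu c b)
    (rspeed (nu mu c) a).
  rewrite /RH_speed !flux_line// !line_stateB scalerA.
  by rewrite (tangent_secant n0 tang).
rewrite /left_char_slow_shock lsa lsb lfb; split=> //.
- by split; apply: line_in; rewrite lexx ltW.
- by rewrite shock_slower_behind ?shock_faster_ahead.
have K0 : 0 < rspeed (nu mu c) a * (1 + nu mu c).
  apply: mulr_gt0; last by rewrite addr_gt0.
  rewrite divr_gt0 ?exprn_gt0 ?rdenom_gt0//.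
  apply: mulr_gt0; last by rewrite subr_gt0 (lt_trans ab).
  by rewrite mulr_gt0// mulr_gt0.
have [s [sab sd sa sb]] := connecting_orbit n0 K0 ab.
exists (line_state mu c \o s); split.
- by move=> t; apply: line_in; have /andP[/ltW-> /ltW->] := sab t.
- move=> t; have := is_derive_line_state mu c (sd t).
  rewrite -profile_rhs//= flux_line// flux_line// !line_stateB.
  by rewrite scalerA -scalerBl.
- exact: cvg_comp sa (@line_state_continuous R mu c _).
- exact: cvg_comp sb (@line_state_continuous R mu c _).
Qed.

Theorem theorem5p3 (R : realType) (mu : phase -> R) (c : phase)
    (M U : 'rV[R]_2)
    (mu_gt0 : forall p : phase, 0 < mu p)
    (nu_lt1 : nu mu c < 1)
    (M_line : invariant_line mu c M)
    (M_range : eff_sat c (umbilic mu) <= eff_sat c M <= s_B0 R)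
    (U_line : invariant_line mu c U)
    (U_range : 0 <= eff_sat c U <= eff_sat c (umbilic mu)) :
  (exists ws : seq (wave * 'rV[R]_2),
     transitional_rarefaction mu U (umbilic mu) M ws) /\
  (eff_sat c (umbilic mu) < eff_sat c M <= s_inflection mu c ->
     transitional_rarefaction mu U (umbilic mu) M
       [:: (Rarefaction Fast, umbilic mu); (Rarefaction Slow, M)]) /\
  (s_inflection mu c < eff_sat c M <= s_B0 R ->
     exists M3 : 'rV[R]_2,
       [/\ invariant_line mu c M3,
           eff_sat c (umbilic mu) <= eff_sat c M3 < s_inflection mu c,
           RH_speed mu M3 M (lambda mu Slow M3) &
           transitional_rarefaction mu U (umbilic mu) M
             [:: (Rarefaction Fast, umbilic mu); (Rarefaction Slow, M3);
                 (LeftCharSlowShock, M)]]).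
Proof.
have n0 := nu_gt0 c mu_gt0.
set u := eff_sat c (umbilic mu) in M_range U_range *.
set b := eff_sat c M in M_range *.
set a := eff_sat c U in U_range.
have uE : u = nu mu c / (1 + nu mu c).
  by rewrite /u (umbilic_line c)// eff_sat_line.
have JE : umbilic mu = line_state mu c u by rewrite (umbilic_line c)// uE.
have ME : M = line_state mu c b by exact: line_state_eff_sat.
have UE : U = line_state mu c a by exact: line_state_eff_sat.
have u0 : 0 < u by rewrite uE divr_gt0// addr_gt0.
have u12 : u < 1 / 2 by rewrite uE ltr_pdivrMr ?addr_gt0//; lra.
have /andP[ub b12] := M_range; rewrite /s_B0 in b12.
have b1 : b < 1 by lra.
have /andP[a0 au] := U_range.
set si := s_inflection mu c.
have [si01 si_root] : 0 <= si <= 1 /\ infl_cubic u si = 0.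
  rewrite /si /s_inflection; case: xgetP => [s _ []//|noroot].
  have [|s] := @infl_cubic_root R u; first by apply/andP; split; lra.
  by move=> /noroot.
have usi := lt_inflection u0 u12 si01 si_root.
have si_root' := si_root; rewrite uE in si_root'.
have fastw : rarefaction mu Fast U (umbilic mu).
  rewrite UE JE; apply: (rarefaction_line mu_gt0 a0 au (ltW usi) si01 si_root').
  by move=> s /andP[_ su]; apply: lambda_line_fast => //; rewrite -uE.
have slow_speed s : u <= s ->
    lambda mu Slow (line_state mu c s) = rspeed (nu mu c) s.
  by rewrite uE => /(lambda_line_slow mu_gt0)[].
have slowr x : u <= x -> x <= si ->
    rarefaction mu Slow (umbilic mu) (line_state mu c x).
  move=> ux xsi; rewrite JE.
  apply: (rarefaction_line mu_gt0 (ltW u0) ux xsi si01 si_root').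
  by move=> s /andP[us _]; exact: slow_speed.
have J_double : lambda mu Fast (umbilic mu) = lambda mu Slow (umbilic mu).
  by rewrite JE slow_speed// lambda_line_fast// uE.
have J_le : lambda mu Fast (umbilic mu) <= lambda mu Slow (umbilic mu).
  by rewrite J_double.
have caseA : b <= si -> transitional_rarefaction mu U (umbilic mu) M
       [:: (Rarefaction Fast, umbilic mu); (Rarefaction Slow, M)].
  move=> bsi; apply: TransRarefaction; first exact: J_double.
  split; [exact: fastw|exact: J_le|].
  by split; [rewrite ME; exact: slowr| |].
have caseB : si < b -> exists M3 : 'rV[R]_2,
       [/\ invariant_line mu c M3,
           u <= eff_sat c M3 < si,
           RH_speed mu M3 M (lambda mu Slow M3) &
           transitional_rarefaction mu U (umbilic mu) M
             [:: (Rarefaction Fast, umbilic mu); (Rarefaction Slow, M3);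
                 (LeftCharSlowShock, M)]].
  move=> sib.
  have [a3 /andP[ua3 a3si] tang] := tangency_foot u0 u12 si01 si_root sib b12.
  have shock : left_char_slow_shock mu (line_state mu c a3) M.
    rewrite uE in ua3 tang; rewrite ME.
    by apply: shock_line => //; exact: lt_trans sib.
  exists (line_state mu c a3); split.
  - apply: invariant_line_state => //; have /andP[_ si1] := si01.
    by rewrite (le_trans (ltW u0) ua3) (le_trans (ltW a3si) si1).
  - by rewrite eff_sat_line// ua3.
  - by case: shock.
  - apply: TransRarefactionShock; first exact: J_double.
    split; [exact: fastw|exact: J_le|].
    split; [exact: slowr (ltW a3si)|exact: lexx|].
    by split; [exact: shock| |].
split; last first.
  by split=> [/andP[_]|/andP[]] ?; [exact: caseA|move=> _; exact: caseB].
have [/caseA ?|/caseB[M3 [_ _ _ ?]]] := leP b si.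
  by exists [:: (Rarefaction Fast, umbilic mu); (Rarefaction Slow, M)].
by exists [:: (Rarefaction Fast, umbilic mu); (Rarefaction Slow, M3);
  (LeftCharSlowShock, M)].
Qed.
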